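(* Let $\mathcal{H}$ and $\mathcal{G}$ be real Hilbert spaces, let $L\colon\mathcal{H}\to\mathcal{G}$ be a bounded linear operator with $0<\|L\|\leq 1$, let $B\colon\mathcal{G}\to 2^{\mathcal{G}}$ be a set-valued operator, let $\gamma\in(0,+\infty)$, let $\alpha\in(0,+\infty)$, and set $\beta=(\alpha+\gamma^{-1})\|L\|^{-2}-\gamma^{-1}$. Suppose that $B$ is $\alpha$-strongly monotone. Then $L\overset{\gamma}{\diamond}B$ is $\beta$-strongly monotone.
   Context: A set-valued operator $A\colon\mathcal{H}\to2^{\mathcal{H}}$ is monotone if $\langle x_1-x_2\mid x_1^*-x_2^*\rangle\geq 0$ whenever $x_1^*\in Ax_1$ and $x_2^*\in Ax_2$; for $\alpha\in(0,+\infty)$, $A$ is $\alpha$-strongly monotone if $A-\alpha\,\mathrm{Id}$ is monotone. $A^{-1}$ is defined by $x\in A^{-1}x^*\Leftrightarrow x^*\in Ax$. Sums, scalar multiples and compositions are pointwise, e.g. $(L^*\circ C\circ L)x=\{L^*y\mid y\in C(Lx)\}$. For a bounded linear $L\colon\mathcal{H}\to\mathcal{G}$ with adjoint $L^*$ and $C\colon\mathcal{G}\to2^{\mathcal{G}}$, the parallel composition is $L^*\triangleright C=(L^*\circ C^{-1}\circ L)^{-1}\colon\mathcal{H}\to2^{\mathcal{H}}$. For $\gamma>0$, the resolvent composition is $L\overset{\gamma}{\diamond}C=L^*\triangleright(C+\gamma^{-1}\mathrm{Id}_{\mathcal{G}})-\gamma^{-1}\mathrm{Id}_{\mathcal{H}}\colon\mathcal{H}\to2^{\mathcal{H}}$.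 *)

(* Defs.v *)
From HB Require Import structures.
From mathcomp Require Import all_boot all_order all_algebra.
From mathcomp Require Import all_classical all_reals all_analysis.

Set Implicit Arguments.
Unset Strict Implicit.
Unset Printing Implicit Defensive.

Import Order.TTheory GRing.Theory Num.Theory.
Import numFieldNormedType.Exports.

Local Open Scope classical_set_scope.
Local Open Scope ring_scope.

(* A real Hilbert space is a complete normed space over the reals whose norm
   comes from an inner product: a symmetric, positive definite bilinear form. *)
HB.mixin Record CompleteNormedModule_isHilbert (R : realType) V
    of CompleteNormedModule R V := {
  inner : {dot V for idfun} ;
  norm_inner : forall x : V, `|x| = Num.sqrt (inner x x)
}.

#[short(type="hilbertType")]
HB.structure Definition Hilbert (R : realType) :=
  {V of CompleteNormedModule_isHilbert R V & CompleteNormedModule R V}.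

(* The supremum is the operator norm only when L is bounded; otherwise sup
   returns a default value. *)
Definition opnorm (R : realType) (V W : normedModType R) (L : V -> W) : R :=
  sup [set `|L x| | x in [set x : V | `|x| <= 1]].

(* For bounded linear L, the Riesz representation theorem gives a unique vector
   in the set below; 0 is a default value that is used for other L only. *)
Definition adjoint (R : realType) (H G : hilbertType R) (L : H -> G) (y : G) :
    H :=
  xget 0 [set u : H | forall x, inner (L x) y = inner x u].

Section SetValuedOperators.
Context {R : realType}.
Implicit Types H G : hilbertType R.

Definition op_id H : H -> set H := fun x => [set x].

Definition op_add H G (A B : H -> set G) : H -> set G :=
  fun x => [set u + v | u in A x & v in B x].

Definition op_scale H G (c : R) (A : H -> set G) : H -> set G :=
  fun x => [set c *: u | u in A x].

Definition op_sub H G (A B : H -> set G) : H -> set G :=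
  fun x => [set u - v | u in A x & v in B x].

Definition op_inv H G (A : H -> set G) : G -> set H :=
  fun u => [set x | A x u].

Definition monotone H (A : H -> set H) : Prop :=
  forall x1 x2 u1 u2, A x1 u1 -> A x2 u2 -> 0 <= inner (x1 - x2) (u1 - u2).

Definition strongly_monotone H (a : R) (A : H -> set H) : Prop :=
  0 < a /\ monotone (op_sub A (op_scale a (@op_id H))).

Definition parallel_comp H G (L : H -> G) (C : G -> set G) : H -> set H :=
  op_inv (fun x : H => adjoint L @` op_inv C (L x)).

Definition resolvent_comp H G (L : H -> G) (gamma : R) (B : G -> set G) :
    H -> set H :=
  op_sub (parallel_comp L (op_add B (op_scale gamma^-1 (@op_id G))))
         (op_scale gamma^-1 (@op_id H)).

End SetValuedOperators.

(* Main.v *)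
Require Import Defs.
From HB Require Import structures.
From mathcomp Require Import all_boot all_order all_algebra.
From mathcomp Require Import all_classical all_reals all_analysis.
From mathcomp Require Import ring lra.

Import Order.TTheory GRing.Theory Num.Theory.
Import numFieldNormedType.Exports.

Local Open Scope classical_set_scope.
Local Open Scope ring_scope.

(* If w = L x lies in B y + y/gamma, a point of the graph of the resolvent
   composition is (L^* y, w - L^* y / gamma).  Strong monotonicity of
   B + Id/gamma gives <L^* dy | dw> = <dy | L dw> >= (alpha + 1/gamma) |dy|^2,
   and |dy| >= |L^* dy| / |L|.  The adjoint is available because the Riesz
   representation theorem holds: near-minimizers x of |x|^2 - 2 f(x) satisfy
   |<x | h> - f(h)| <= e |h|, and such x form a Cauchy family as e tends to 0. *)

Section InnerProduct.
Context {R : realType} {H : hilbertType R}.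
Implicit Types x y z : H.

Lemma innerC x y : inner x y = inner y x.
Proof. by rewrite (hermC (inner : {hermitian H for false & idfun})) expr0 mul1r. Qed.

Lemma innerDl x y z : inner (x + y) z = inner x z + inner y z.
Proof. by rewrite linearDl. Qed.

Lemma innerBl x y z : inner (x - y) z = inner x z - inner y z.
Proof. by rewrite linearBl. Qed.

Lemma innerZl a x y : inner (a *: x) y = a * inner x y.
Proof. by rewrite linearZl_LR. Qed.

Lemma innerDr x y z : inner x (y + z) = inner x y + inner x z.
Proof. by rewrite innerC innerDl !(innerC _ x). Qed.

Lemma innerBr x y z : inner x (y - z) = inner x y - inner x z.
Proof. by rewrite innerC innerBl !(innerC _ x). Qed.

Lemma innerZr a x y : inner x (a *: y) = a * inner x y.
Proof. by rewrite innerC innerZl innerC. Qed.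

Lemma innerxx x : inner x x = `|x| ^+ 2.
Proof.
rewrite norm_inner sqr_sqrtr//; have [->|x0] := eqVneq x 0.
  by rewrite linear0l.
exact/ltW/neq0_dnorm_gt0.
Qed.

(* Squaring the triangle inequality, which the norm has by assumption. *)
Lemma inner_le_norm x y : inner x y <= `|x| * `|y|.
Proof.
have := innerxx (x + y); rewrite innerDl !innerDr !innerxx (innerC y x).
have := lerXn2r 2 (normr_ge0 _) (addr_ge0 (normr_ge0 x) (normr_ge0 y)) (ler_normD x y).
by move: (`|x|) (`|y|) (`|x + y|) (inner x y) => a b c d; nra.
Qed.

Lemma normr_inner_le x y : `|inner x y| <= `|x| * `|y|.
Proof.
rewrite ler_norml inner_le_norm andbT lerNl -mulN1r -innerZl.
by rewrite (le_trans (inner_le_norm _ _))// scaleN1r normrN.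
Qed.

End InnerProduct.

Section Riesz.
Context {R : realType} {H : hilbertType R} (f : H -> R) (M : R).
Hypothesis f_linear : scalar f.
Hypothesis f_bounded : forall x, `|f x| <= M * `|x|.

Lemma approximate_riesz (e : R) : 0 < e ->
  exists x, forall h, `|inner x h - f h| <= e * `|h|.
Proof.
move=> e0.
pose J x := `|x| ^+ 2 - 2 * f x.
have Jinf : has_inf (range J).
  split; first by exists (J 0), 0.
  (* Since [f x] is at most [M * |x|], [J x + M ^+ 2] is bounded below by the square of
     [|x| - M]. *)
  exists (- M ^+ 2) => _ [x _ <-]; rewrite /J.
  have := f_bounded x; rewrite ler_norml => /andP[_].
  have := sqr_ge0 (`|x| - M).
  by move: (f x) (`|x|) => a b; nra.
(* The tolerance is [e ^+ 2] because minimizing the quadratic in [t] below bounds the square of the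
   error by [e ^+ 2 * |h| ^+ 2]. *)
have [_ [x _ <-] Jx] := inf_adherent (exprn_gt0 2 e0) Jinf.
exists x => h.
have Jmin t : J x < J (t *: h + x) + e ^+ 2.
  by rewrite (lt_le_trans Jx)// lerD2r; apply: ge_inf; [exact: Jinf.2|exists (t *: h + x)].
have Jexp t : 0 < t ^+ 2 * `|h| ^+ 2 + 2 * t * (inner x h - f h) + e ^+ 2.
  have := Jmin t; rewrite /J f_linear -(innerxx (_ + _)) innerDl !innerDr !innerZl !innerZr.
  rewrite !innerxx (innerC h x).
  by move: (`|x|) (`|h|) (f x) (f h) (inner x h) => a b c d g; nra.
have [h0|h0] := eqVneq h 0.
  rewrite h0 linear0r normr0 mulr0 sub0r normrN.
  by have := f_bounded 0; rewrite normr0 mulr0.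
have hp : 0 < `|h| by rewrite normr_gt0.
(* t = -d / |h|^2 minimizes the quadratic in Jexp. *)
move: Jexp hp; move: (inner x h - f h) (`|h|) => d b Jexp b0.
have := Jexp (- d / b ^+ 2).
have -> : (- d / b ^+ 2) ^+ 2 * b ^+ 2 + 2 * (- d / b ^+ 2) * d + e ^+ 2
  = e ^+ 2 - d ^+ 2 / b ^+ 2 by field; rewrite gt_eqF.
rewrite subr_gt0 ltr_pdivrMr ?exprn_gt0// -exprMn => /ltW.
have eb0 : 0 <= e * b by rewrite mulr_ge0// ltW.
by rewrite -[d ^+ 2]real_normK ?num_real// ler_sqr.
Qed.

(** Tolerances [1/(n+1)] give a sequence of approximate representers; completeness supplies its
    limit, which represents [f] by continuity of the inner product. *)
Theorem riesz_representation : exists u, forall x, f x = inner x u.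
Proof.
have e_gt0 n : 0 < n.+1%:R^-1 :> R by rewrite invr_gt0 ltr0n.
have [u uP] := choice (fun n => approximate_riesz _ (e_gt0 n)).
have u_dist m n : `|u m - u n| <= m.+1%:R^-1 + n.+1%:R^-1.
  have [->|mn] := eqVneq (u m - u n) 0.
    by rewrite normr0 addr_ge0// ltW.
  (* Both approximations are tested on [h = u m - u n]: the [f h] terms cancel and one factor [|h|]
     divides out. *)
  rewrite -(ler_pM2r (_ : 0 < `|u m - u n|)) ?normr_gt0// -expr2 -innerxx innerBl.
  have := uP m (u m - u n); have := uP n (u m - u n).
  move: (inner (u m) _) (inner (u n) _) (f _) (m.+1%:R^-1) (n.+1%:R^-1) (`|u m - u n|).
  by move=> ? ? ? ? ? ?; rewrite !ler_norml => /andP[] ? ? /andP[] ? ?; lra.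
have u_cvg : cvg (u @ \oo).
  apply: cauchy_cvg; apply: cauchy_exP => e e0.
  have e20 : 0 < e / 2 by lra.
  have [N _ NP] := near_infty_natSinv_lt (PosNum e20).
  exists (u N), N => // n /= Nn; rewrite -ball_normE /=.
  apply: le_lt_trans (u_dist _ _) _.
  by rewrite [ltRHS]splitr ltrD//; apply: NP => /=.
pose v := lim (u @ \oo).
exists v => x; rewrite innerC; apply/eqP; rewrite eq_sym -subr_eq0 -normr_le0.
apply/ler_addgt0Pr => e e0; rewrite add0r.
(* Two errors of at most [e / 2] each will be added; [|x| + 1] in place of [|x|] keeps the
   denominator positive at [x = 0]. *)
have d0 : 0 < e / (2 * (`|x| + 1)) by rewrite divr_gt0// mulr_gt0// ltr_wpDl.
have [N _ NP] := near_infty_natSinv_lt (PosNum d0).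
have [K _ KP] := (cvgrPdist_lt _ _).1 u_cvg _ d0.
pose n := maxn N K.
have /= h1 := NP n (leq_maxl N K); have /= h2 := KP n (leq_maxr N K).
have h3 := uP n x.
have h4 : `|inner v x - inner (u n) x| <= `|v - u n| * `|x|.
  by rewrite -innerBl normr_inner_le.
have -> : e = e / (2 * (`|x| + 1)) * (`|x| + 1) + e / (2 * (`|x| + 1)) * (`|x| + 1).
  by field; rewrite gt_eqF// ltr_wpDl.
have x0 := normr_ge0 x.
rewrite (le_trans (ler_distD (inner (u n) x) _ _))// lerD//.
  by rewrite (le_trans h4)// ler_pM// ?ltW// ?ltrDl.
by rewrite (le_trans h3)// ler_pM// ?ltW// ?ltrDl.
Qed.

End Riesz.

Section Adjoint.
Context {R : realType} {H G : hilbertType R} (L : {linear H -> G}).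
Hypothesis L_bounded : bounded_fun_norm L.

(** Scaling reduces to unit vectors, where boundedness of [L] makes the supremum a genuine upper
    bound. *)
Lemma normr_le_opnorm x : `|L x| <= opnorm L * `|x|.
Proof.
have [->|x0] := eqVneq x 0; first by rewrite linear0 !normr0 mulr0.
have xp : 0 < `|x| by rewrite normr_gt0.
have -> : `|L x| = `|L (`|x|^-1 *: x)| * `|x|.
  by rewrite linearZ normrZ normfV normr_id mulrAC mulVf ?mul1r// gt_eqF.
rewrite ler_pM2r//; apply: ub_le_sup.
  by have [M MP] := L_bounded 1; exists M => _ [z z1 <-]; exact: MP.
by exists (`|x|^-1 *: x) => //=; rewrite normrZ normfV normr_id mulVf// gt_eqF.
Qed.

(** Riesz representation of [x |-> inner (L x) y] shows that the set in [adjoint] is inhabited, so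
    [xget] does not return its default 0. *)
Lemma inner_adjoint x y : inner (L x) y = inner x (adjoint L y).
Proof.
have [||u uP] := @riesz_representation R H (fun x => inner (L x) y) (opnorm L * `|y|).
- by move=> a z t /=; rewrite linearP innerDl innerZl.
- move=> z; rewrite mulrAC (le_trans (normr_inner_le _ _))//.
  by rewrite ler_wpM2r// normr_le_opnorm.
by have /(_ x) := @xgetI _ 0 [set u | forall x, inner (L x) y = inner x u] u uP.
Qed.

End Adjoint.

Theorem corollary4p2 (R : realType) (H G : hilbertType R)
    (L : {linear H -> G}) (B : G -> set G) (gamma alpha : R)
    (L_bounded : bounded_fun_norm L)
    (L_norm : 0 < opnorm L <= 1)
    (gamma_gt0 : 0 < gamma) (alpha_gt0 : 0 < alpha)
    (B_strong : strongly_monotone alpha B) :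
  let beta := (alpha + gamma^-1) * (opnorm L) ^- 2 - gamma^-1 in
  strongly_monotone beta (resolvent_comp L gamma B).
Proof.
move=> beta; case/andP: L_norm => L0 L1.
have g0 : 0 < gamma^-1 by rewrite invr_gt0.
split.
  (* This gives [beta >= alpha > 0]. *)
  have : 1 <= (opnorm L) ^- 2 by rewrite invf_ge1 ?exprn_gt0// exprn_ile1// ltW.
  by rewrite /beta; nra.
move=> x1 x2 u1 u2.
(* Unfolding the graph yields [y1] and [b1] in [B y1] with [adjoint L y1 = x1] and
   [b1 + gamma^-1 *: y1 = L w1]. *)
move=> [_ [w1 [y1 [b1 By1 [_ [_ -> <-] E1]] X1] [_ [_ -> <-] <-]] [_ [_ -> <-] <-]].
move=> [_ [w2 [y2 [b2 By2 [_ [_ -> <-] E2]] X2] [_ [_ -> <-] <-]] [_ [_ -> <-] <-]].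
have Bmono : 0 <= inner (y1 - y2) ((b1 - alpha *: y1) - (b2 - alpha *: y2)).
  by apply: B_strong.2;
    [exists b1 => //; exists (alpha *: y1) => //; exists y1
    |exists b2 => //; exists (alpha *: y2) => //; exists y2].
have mono : (alpha + gamma^-1) * `|y1 - y2| ^+ 2 <= inner (x1 - x2) (w1 - w2).
  rewrite innerC -X1 -X2 innerBr -!inner_adjoint// -innerBr [L _]linearB -E1 -E2.
  rewrite innerC -subr_ge0; apply: le_trans Bmono _.
  by rewrite -innerxx !innerBr !innerDr !innerZr; lra.
have xy : `|x1 - x2| <= opnorm L * `|y1 - y2|.
  have [->|x0] := eqVneq (x1 - x2) 0; first by rewrite normr0 mulr_ge0// ltW.
  (* Writing [|x1 - x2| ^+ 2] as [inner (L (x1 - x2)) (y1 - y2)] needs only the norm of [L], not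
     that of its adjoint. *)
  rewrite -(ler_pM2r (_ : 0 < `|x1 - x2|)) ?normr_gt0// -expr2 -innerxx.
  rewrite -{2}X1 -{2}X2 innerBr -!inner_adjoint// -innerBr.
  rewrite (le_trans (inner_le_norm _ _))// mulrAC ler_wpM2r//.
  exact: normr_le_opnorm.
have -> : inner (x1 - x2)
    (w1 - gamma^-1 *: x1 - beta *: x1 - (w2 - gamma^-1 *: x2 - beta *: x2)) =
    inner (x1 - x2) (w1 - w2) - (beta + gamma^-1) * `|x1 - x2| ^+ 2.
  by rewrite -innerxx !innerBr !innerZr; ring.
(* The shift by [gamma^-1] in [beta] cancels, leaving the factor
   [(alpha + gamma^-1) * opnorm L ^- 2], which [xy] squared absorbs. *)
rewrite /beta subrK subr_ge0; apply: le_trans mono.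
rewrite -mulrA ler_pM2l ?addr_gt0// mulrC ler_pdivrMr ?exprn_gt0//.
by rewrite mulrC -exprMn ler_sqr ?nnegrE ?mulr_ge0// ltW.
Qed.
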